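(* For any rule $\mathcal{R}$, any graphon $W\in\mathcal{W}_0$ and every $t>0$, the sets $$A_t:=\{(x,y)\in\Omega^2: W(x,y)>0,\ \Phi^tW(x,y)=0\},\qquad B_t:=\{(x,y)\in\Omega^2: W(x,y)<1,\ \Phi^tW(x,y)=1\}$$ have ($\pi^2$-)measure zero.
   Context: $(\Omega,\pi)$ is a fixed atomless probability space whose sigma-algebra is separable (there is a countable family $\mathcal{C}$ of measurable sets such that for every measurable $S$ and $\delta>0$ some $T\in\mathcal{C}$ has $\pi(S\ominus T)<\delta$). $\mathcal{W}$ is the Banach space of kernels: bounded measurable functions $W:\Omega^2\to\mathbb{R}$ with $W(x,y)=W(y,x)$ a.e., identified when equal a.e., with the $L^\infty$-norm $\|\cdot\|_\infty$. $\mathcal{W}_0\subset\mathcal{W}$ is the set of graphons: kernels with values in $[0,1]$ a.e. $\mathcal{H}_k$ is the set of all (simple, labelled) graphs on vertex set $[k]$. A rule of order $k$ is a matrix $\mathcal{R}\in[0,1]^{\mathcal{H}_k\times\mathcal{H}_k}$ with $\sum_{J}\mathcal{R}_{H,J}=1$ for every $H\in\mathcal{H}_k$. For $F\in\mathcal{H}_k$, distinct $a,b\in[k]$ and $W\in\mathcal{W}$ define $$(T_F^{a,b}W)(x,y)=\int\prod_{ij\in E(F)}W(x_i,x_j)\prod_{ij\notin E(F)}(1-W(x_i,x_j))\prod_{i\in[k]\setminus\{a,b\}}\pi(\mathrm{d}x_i),\quad x_a=x,\ x_b=y,$$ where $ij$ ranges over unordered pairs of distinct elements of $[k]$. The velocity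 operator is $$\mathfrak{V}_{\mathcal{R}}W=\sum_{F,H\in\mathcal{H}_k}\mathcal{R}_{F,H}\sum_{1\le a\ne b\le k}T_F^{a,b}W\cdot\left(\mathbb{I}_{\{ab\in E(H)\setminus E(F)\}}-\mathbb{I}_{\{ab\in E(F)\setminus E(H)\}}\right),$$ the inner sum being over ordered pairs. For a graphon $W$, $t\mapsto\Phi^tW$ is the unique solution of $\frac{\mathrm{d}}{\mathrm{d}t}\Phi^tW=\mathfrak{V}_{\mathcal{R}}\Phi^tW$, $\Phi^0W=W$ (derivative with respect to $\|\cdot\|_\infty$), which exists for all $t\ge0$ and stays in $\mathcal{W}_0$ for $t\ge 0$. *)

(* Defs.v *)
From HB Require Import structures.
From mathcomp Require Import all_boot all_order all_algebra.
From mathcomp Require Import all_classical all_reals all_analysis.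
Import Order.TTheory GRing.Theory Num.Theory.
Import numFieldNormedType.Exports.

Set Implicit Arguments.
Unset Strict Implicit.
Unset Printing Implicit Defensive.

Local Open Scope classical_set_scope.
Local Open Scope ring_scope.

Definition atomless (d : measure_display) (Omega : measurableType d)
    (R : realType) (pi : probability Omega R) : Prop :=
  forall A : set Omega, measurable A -> (0 < pi A)%E ->
    exists B : set Omega,
      [/\ measurable B, B `<=` A, (0 < pi B)%E & (pi B < pi A)%E].

Definition separable (d : measure_display) (Omega : measurableType d)
    (R : realType) (pi : probability Omega R) : Prop :=
  exists C : set (set Omega),
    [/\ countable C, C `<=` measurable &
        forall (S : set Omega) (delta : R), measurable S -> 0 < delta ->
          exists2 T, C T & (pi ((S `\` T) `|` (T `\` S)) < delta%:E)%E].

(* Kernels and graphons are handled through representatives: functions that are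
   bounded everywhere, equality in the Banach space of kernels being equality
   almost everywhere. Every class has such a representative. *)
Definition is_kernel (d : measure_display) (Omega : measurableType d)
    (R : realType) (pi : probability Omega R) (W : Omega * Omega -> R) : Prop :=
  [/\ measurable_fun [set: Omega * Omega] W,
      exists M : R, forall z, `|W z| <= M &
      {ae (pi \x pi)%E, forall z, W (z.1, z.2) = W (z.2, z.1)}].

Definition is_graphon (d : measure_display) (Omega : measurableType d)
    (R : realType) (pi : probability Omega R) (W : Omega * Omega -> R) : Prop :=
  is_kernel pi W /\ {ae (pi \x pi)%E, forall z, 0 <= W z <= 1}.

(* Simple graphs on the vertex set 'I_k, given by their edge sets. *)
Definition sgraph (k : nat) : finType :=
  {E : {set {set 'I_k}} | [forall e in E, #|e| == 2%N]}.

Definition edge (k : nat) (F : sgraph k) (i j : 'I_k) : bool :=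
  [set i; j]%SET \in val F.

Definition is_rule (R : realType) (k : nat)
    (rule : sgraph k -> sgraph k -> R) : Prop :=
  (forall F H, 0 <= rule F H <= 1) /\ (forall F, \sum_H rule F H = 1).

(* The pair (i, j) with i < j represents the unordered pair ij; since W is
   symmetric almost everywhere, the orientation only matters on null sets. *)
Definition graph_weight (d : measure_display) (Omega : measurableType d)
    (R : realType) (k : nat) (F : sgraph k) (W : Omega * Omega -> R)
    (x : 'I_k -> Omega) : R :=
  (\prod_(p : 'I_k * 'I_k | (p.1 < p.2)%N && edge F p.1 p.2)
      W (x p.1, x p.2)) *
  (\prod_(p : 'I_k * 'I_k | (p.1 < p.2)%N && ~~ edge F p.1 p.2)
      (1 - W (x p.1, x p.2))).

(* Integral of f with respect to the coordinates listed in s, the others being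
   fixed by x. For bounded measurable f and duplicate-free s this iterated
   integral is, by Fubini, the integral against the product of copies of pi. *)
Fixpoint integrate_coords (d : measure_display) (Omega : measurableType d)
    (R : realType) (pi : probability Omega R) (k : nat) (s : seq 'I_k)
    (f : ('I_k -> Omega) -> R) (x : 'I_k -> Omega) : R :=
  if s is i :: s' then
    \int[pi]_u integrate_coords pi s' f (fun j => if j == i then u else x j)
  else f x.

(* The starting assignment below sets x_a = z.1 and x_b = z.2; its values at the
   other coordinates are irrelevant, since these are all integrated out. *)
Definition TF (d : measure_display) (Omega : measurableType d)
    (R : realType) (pi : probability Omega R) (k : nat) (F : sgraph k)
    (a b : 'I_k) (W : Omega * Omega -> R) (z : Omega * Omega) : R :=
  integrate_coords pi [seq i <- enum 'I_k | (i != a) && (i != b)]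
    (graph_weight F W) (fun i => if i == b then z.2 else z.1).

Definition velocity (d : measure_display) (Omega : measurableType d)
    (R : realType) (pi : probability Omega R) (k : nat)
    (rule : sgraph k -> sgraph k -> R) (W : Omega * Omega -> R)
    (z : Omega * Omega) : R :=
  \sum_(F : sgraph k) \sum_(H : sgraph k) rule F H *
    (\sum_(a < k) \sum_(b < k | a != b) TF pi F a b W z *
       ((edge H a b && ~~ edge F a b)%:R - (edge F a b && ~~ edge H a b)%:R)).

(* Phi solves Phi' = velocity Phi, Phi 0 = W in the space of kernels on the time
   interval [0, +oo[, the derivative being taken in L^oo norm (one-sided at 0).
   Values of Phi at negative times are not used. *)
Definition is_trajectory (d : measure_display) (Omega : measurableType d)
    (R : realType) (pi : probability Omega R) (k : nat)
    (rule : sgraph k -> sgraph k -> R) (W : Omega * Omega -> R)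
    (Phi : R -> Omega * Omega -> R) : Prop :=
  [/\ forall t : R, 0 <= t -> is_kernel pi (Phi t),
      {ae (pi \x pi)%E, forall z, Phi 0 z = W z} &
      forall t : R, 0 <= t ->
        Lnorm (pi \x pi)%E +oo%E (fun z =>
           ((s - t)^-1 * (Phi s z - Phi t z) - velocity pi rule (Phi t) z)%:E)
          @[s --> within [set s : R | 0 <= s] t^'] --> 0%E].

(* Main.v *)
(* The velocity removes an edge at a rate at most C times its density and creates
   one at a rate at most C times the density of non-edges. Hence, with
   m(s) = exp(-(C+1)s), the graphon flow should stay between the barriers m W and
   1 - m (1 - W), which gives the claim. As the flow is not known a priori to
   stay in [0, 1], one propagates instead the barriers relaxed by an error
   eps exp(Ks): being within dl <= 1 of [0, 1] degrades the velocity estimates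
   only by O(dl). The L^oo derivative gives no pointwise differentiability in t,
   so the comparison is a real induction on time with Euler steps, after which
   eps tends to 0. *)
Require Import Defs.
From mathcomp Require Import all_boot all_order all_algebra.
From mathcomp Require Import all_classical all_reals all_analysis.
From mathcomp Require Import measurable_realfun ess_sup_inf ring lra.
Import Order.TTheory GRing.Theory Num.Theory.
Import numFieldNormedType.Exports.

Set Implicit Arguments.
Unset Strict Implicit.
Unset Printing Implicit Defensive.

Local Open Scope classical_set_scope.
Local Open Scope ring_scope.

(** * Iterated integrals and almost-everywhere statements over coordinates *)

Section coordinate_integrals.
Context (R : realType) (d : measure_display) (Omega : measurableType d)
  (pi : probability Omega R).

(** Truncating [g] to [[lo, hi]] changes it only on a null set and makes it integrable; constants
    integrate to themselves because [pi] has mass 1. *)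
Lemma Rintegral_ae_bounds (g : Omega -> R) (lo hi : R) :
  measurable_fun setT g -> lo <= hi ->
  {ae pi, forall u, lo <= g u <= hi} -> lo <= \int[pi]_u g u <= hi.
Proof.
move=> mg lohi gb.
pose g' u := Num.max lo (Num.min hi (g u)).
have mg' : measurable_fun setT g'.
  by apply: measurable_maxr => //; apply: measurable_minr.
have g'b u : lo <= g' u <= hi by rewrite /g' le_max lexx ge_max lohi ge_min lexx.
have int_cst (c : R) : pi.-integrable setT (EFin \o cst c).
  by apply: finite_measure_integrable_cst.
have int_g' : pi.-integrable setT (EFin \o g').
  apply: measurable_bounded_integrable => //.
    by rewrite -ge0_fin_numE// fin_num_measure.
  exists (`|lo| + `|hi|); split; first exact: num_real.
  move=> x xgt u _; apply: ltW; apply: le_lt_trans xgt.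
  have /andP[l h] := g'b u.
  have := ler_norm hi; have := ler_norm (- lo); rewrite normrN => nl nh.
  have := normr_ge0 hi; have := normr_ge0 lo.
  by rewrite ler_norml => ? ?; apply/andP; split; lra.
have -> : \int[pi]_u g u = \int[pi]_u g' u.
  rewrite /Rintegral; congr fine; apply: ae_eq_integral => //.
  - exact/measurable_EFinP.
  - exact/measurable_EFinP.
  apply: filterS gb => u /andP[l h] _; congr EFin.
  by rewrite /g' (min_r h) (max_r l).
have cstE c : \int[pi]_u cst c u = c.
  rewrite (Rintegral_cst pi measurableT c) -[RHS]mulr1; congr (c * _).
  exact: (congr1 fine (probability_setT pi)).
apply/andP; split.
  by rewrite -{1}(cstE lo); apply: le_Rintegral => // u _; case/andP: (g'b u).
by rewrite -[leRHS](cstE hi); apply: le_Rintegral => // u _; case/andP: (g'b u).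
Qed.

Lemma measurable_Rintegral_section d' (T : measurableType d')
    (g : T * Omega -> R) :
  measurable_fun setT g -> measurable_fun setT (fun t => \int[pi]_u g (t, u)).
Proof.
move=> mg; apply: measurableT_comp => //.
have mG : measurable_fun setT (EFin \o g) by exact/measurable_EFinP.
rewrite [X in measurable_fun _ X](_ : _ =
    fubini_F pi ((EFin \o g)^\+) \- fubini_F pi ((EFin \o g)^\-))%E; last first.
  apply/funext => t; rewrite integralE /fubini_F /=.
  by congr (_ - _)%E; apply: eq_integral => u _; rewrite ?funeposE ?funenegE.
apply: emeasurable_funB; apply: measurable_fun_fubini_tonelli_F => //.
- exact: measurable_funepos.
- exact: measurable_funeneg.
Qed.

Context (k : nat).
Implicit Types (f : ('I_k -> Omega) -> R) (x : 'I_k -> Omega) (s : seq 'I_k).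

Definition upd x (i : 'I_k) (u : Omega) : 'I_k -> Omega :=
  fun j => if j == i then u else x j.

(* Measurability for the product sigma-algebra on ['I_k -> Omega], tested on
   arbitrary measurable families of assignments. *)
Definition coord_measurable f := forall d' (T : measurableType d')
  (h : T -> 'I_k -> Omega), (forall i, measurable_fun setT (fun t => h t i)) ->
  measurable_fun setT (f \o h).

(** Each integration enlarges the parameter space from [T] to [T * Omega]; the induction closes
    because measurability is tested on arbitrary families. *)
Lemma integrate_coords_measurable s f :
  coord_measurable f -> coord_measurable (integrate_coords pi s f).
Proof.
move=> mf; elim: s => [//|i s IH] d' T h mh /=.
apply: (@measurable_Rintegral_section _ T
  (fun tu => integrate_coords pi s f (upd (h tu.1) i tu.2))).
apply: (IH _ _ (fun tu : T * Omega => upd (h tu.1) i tu.2)) => j.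
rewrite /upd; case: (j == i).
  exact: measurable_snd.
exact: measurableT_comp (mh j) measurable_fst.
Qed.

(** The almost-everywhere quantifiers are nested in the order of [integrate_coords], so that bounds
    pass through one integral at a time. *)
Fixpoint ae_coords s (P : ('I_k -> Omega) -> Prop) x : Prop :=
  if s is i :: s' then {ae pi, forall u, ae_coords s' P (upd x i u)} else P x.

Lemma ae_coordsS s (P Q : ('I_k -> Omega) -> Prop) x :
  (forall y, (forall i, i \notin s -> y i = x i) -> P y -> Q y) ->
  ae_coords s P x -> ae_coords s Q x.
Proof.
elim: s x => [|i s IH] x /= PQ; first by apply: PQ.
apply: filterS => u; apply: IH => y yE; apply: PQ => j.
by rewrite inE negb_or => /andP[ji js]; rewrite yE// /upd (negbTE ji).
Qed.

Lemma integrate_coords_bounds s f x (lo hi : R) :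
  coord_measurable f -> lo <= hi -> ae_coords s (fun y => lo <= f y <= hi) x ->
  lo <= integrate_coords pi s f x <= hi.
Proof.
move=> mf lohi; elim: s x => [//|i s IH] x /= H.
apply: Rintegral_ae_bounds => //; last by apply: filterS H => u; apply: IH.
apply: (@integrate_coords_measurable s _ mf _ _ (upd x i)) => j.
rewrite /upd; case: (j == i) => //; exact: measurable_id.
Qed.

(** The measures of the sections of a null set integrate to 0, so almost every section is null. *)
Lemma ae_section_l (P : Omega * Omega -> Prop) :
  {ae (pi \x pi)%E, forall z, P z} ->
  {ae pi, forall v, {ae pi, forall u, P (v, u)}}.
Proof.
move=> [N [mN N0 PN]].
have : (pi \o xsection N) = cst 0%E %[ae pi].
  have := @ae_eq_integral_abs _ _ _ pi setT measurableT (pi \o xsection N).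
  move=> /(_ (measurable_fun_xsection pi mN)) [+ _]; apply.
  by rewrite -[RHS]N0 /product_measure1; apply: eq_integral => u _; rewrite gee0_abs.
apply: filterS => v /(_ I) /= Nv0; exists (xsection N v); split => //.
  exact: measurable_xsection.
by move=> u /= Pu; rewrite /xsection /= inE; apply: PN.
Qed.

Lemma ae_section_r (P : Omega * Omega -> Prop) :
  {ae (pi \x pi)%E, forall z, P z} ->
  {ae pi, forall v, {ae pi, forall u, P (u, v)}}.
Proof.
move=> [N [mN N0 PN]].
have : (pi \o ysection N) = cst 0%E %[ae pi].
  have := @ae_eq_integral_abs _ _ _ pi setT measurableT (pi \o ysection N).
  move=> /(_ (measurable_fun_ysection pi mN)) [+ _]; apply.
  (* By uniqueness, the product measure is also computed by integrating in the other order. *)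
  rewrite -[RHS]N0 (@product_measure_unique _ _ _ _ _ pi pi (pi \x^ pi)%E) //.
    by apply: eq_integral => u _; rewrite gee0_abs.
  by move=> *; exact: product_measure2E.
apply: filterS => v /(_ I) /= Nv0; exists (ysection N v); split => //.
  exact: measurable_ysection.
by move=> u /= Pu; rewrite /ysection /= inE; apply: PN.
Qed.

Lemma ae_fst (P : Omega -> Prop) : {ae pi, forall v, P v} ->
  {ae (pi \x pi)%E, forall z, P z.1}.
Proof.
move=> [N [mN N0 PN]]; exists (N `*` setT); split.
- exact: measurableX.
- rewrite (product_measure1E pi pi mN measurableT) -[RHS](mul0e (pi setT)).
  by congr (_ * _)%E; exact: N0.
- by move=> z Pz; split => //; apply: PN.
Qed.

Lemma ae_snd (P : Omega -> Prop) : {ae pi, forall v, P v} ->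
  {ae (pi \x pi)%E, forall z, P z.2}.
Proof.
move=> [N [mN N0 PN]]; exists (setT `*` N); split.
- exact: measurableX.
- rewrite (product_measure1E pi pi measurableT mN) -[RHS](mule0 (pi setT)).
  by congr (_ * _)%E; exact: N0.
- by move=> z Pz; split => //; apply: PN.
Qed.

(** Invariant of the induction: each coordinate outside [s], already fixed, satisfies [P] with
    almost every point in both orders, and fixed pairs satisfy [P]. Almost every new value preserves
    this, as there are finitely many fixed coordinates. *)
Lemma ae_coords_pairs (P : Omega * Omega -> Prop) s x :
  {ae (pi \x pi)%E, forall z, P z} ->
  (forall j : 'I_k, j \notin s -> {ae pi, forall u, P (x j, u)} /\
                           {ae pi, forall u, P (u, x j)}) ->
  (forall i j : 'I_k, i \notin s -> j \notin s -> (i < j)%N -> P (x i, x j)) ->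
  ae_coords s (fun y => forall i j : 'I_k, (i < j)%N -> P (y i, y j)) x.
Proof.
move=> aeP; elim: s x => [|i s IH] x /= Px xx; first by move=> i j; apply: xx.
have Pxu : {ae pi, forall u, forall j, j \notin i :: s -> P (x j, u) /\ P (u, x j)}.
  apply: filter_forall => j; have [/Px[Pl Pr]|_] := boolP (j \notin i :: s).
    by apply: filterS2 Pl Pr => u ? ? _.
  by apply: aeW.
apply: filterS3 (ae_section_l aeP) (ae_section_r aeP) Pxu => u Pl Pr Pu.
apply: IH => [j js|j l js ls jl]; rewrite /upd.
  by case: eqP => [//|/eqP ji]; apply: Px; rewrite inE negb_or ji.
case: eqP jl => [->|/eqP ji] jl; case: eqP jl => [->|/eqP li] jl.
- by rewrite ltnn in jl.
- by apply: (Pu l _).2; rewrite inE negb_or li.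
- by apply: (Pu j _).1; rewrite inE negb_or ji.
- by apply: xx => //; rewrite inE negb_or ?ji ?li.
Qed.

End coordinate_integrals.

(** * Elementary bounds on finite products and sums *)

(** A slightly negative factor times a large product spoils the sign, so the lower bound needs the
    absolute bound in the same induction. Factors are at most [1 + dl <= 2] in absolute value. *)
Lemma prod_almost_unit (R : realDomainType) (I : Type) (r : seq I) (P : pred I)
    (X : I -> R) (dl : R) : 0 <= dl <= 1 ->
  (forall i, P i -> - dl <= X i <= 1 + dl) ->
  `|\prod_(i <- r | P i) X i| <= 2 ^+ size r /\
  - (dl * 2 ^+ size r) <= \prod_(i <- r | P i) X i.
Proof.
move=> /andP[d0 d1] XP; elim: r => [|i r [IH1 IH2]].
  by rewrite big_nil expr0 normr1 mulr1; split=> //; lra.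
have N0 : 0 <= 2 ^+ size r :> R by rewrite exprn_ge0.
have dN0 : 0 <= dl * 2 ^+ size r by rewrite mulr_ge0.
rewrite big_cons /= exprS.
case: ifPn => [/XP/andP[Xl Xu]|_]; last by split; lra.
set p := \prod_(_ <- _ | _) _ in IH1 IH2 *; set N := 2 ^+ _ in IH1 IH2 N0 dN0 *.
have Xa : `|X i| <= 2 by rewrite ler_norml; apply/andP; split; lra.
split; first by rewrite normrM ler_pM.
move: IH1; rewrite ler_norml => /andP[_ pN].
have [X0|/ltW X0] := leP 0 (X i).
  have := mulr_ge0 X0 (_ : 0 <= p + dl * N); rewrite -lerBlDr sub0r => /(_ IH2).
  have : 0 <= (1 + dl - X i) * (dl * N) by rewrite mulr_ge0// subr_ge0.
  have : 0 <= (1 - dl) * (dl * N) by rewrite mulr_ge0// subr_ge0.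
  by lra.
have [p0|/ltW p0] := leP 0 p; last first.
  have := mulr_le0 X0 p0; lra.
have : 0 <= (X i + dl) * p by rewrite mulr_ge0//; lra.
have : 0 <= dl * (N - p) by rewrite mulr_ge0// subr_ge0.
by lra.
Qed.

Lemma sum_bounds (R : realDomainType) (I : finType) (P : pred I) (f : I -> R)
    (B1 B2 : R) : 0 <= B1 -> 0 <= B2 ->
  (forall i, P i -> - B1 <= f i <= B2) ->
  - (#|I|%:R * B1) <= \sum_(i | P i) f i <= #|I|%:R * B2.
Proof.
move=> B10 B20 fB.
have cst c : \sum_(i : I) c = #|I|%:R * c by rewrite sumr_const mulr_natl.
rewrite big_mkcond -mulrN -!cst; apply/andP.
by split; apply: ler_sum => i _; case: ifPn => [/fB/andP[]//|_];
  rewrite ?oppr_le0.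
Qed.

Lemma edgeC (k : nat) (F : sgraph k) (i j : 'I_k) : edge F i j = edge F j i.
Proof. by rewrite /edge finset.setUC. Qed.

(** * Bounds on the velocity of an almost [[0, 1]]-valued kernel *)

Section velocity_bounds.
Context (R : realType) (d : measure_display) (Omega : measurableType d)
  (pi : probability Omega R) (k : nat).
Implicit Types (U : Omega * Omega -> R) (F H : sgraph k) (y : 'I_k -> Omega).

(** A crude constant: one factor 2 for every ordered pair of vertices. *)
Let N : R := 2 ^+ size (index_enum ('I_k * 'I_k)%type).

Let N_ge0 : 0 <= N. Proof. by rewrite exprn_ge0. Qed.

(** Merging both products allows the factor of one given pair to be extracted, whether or not it is
    an edge. *)
Lemma graph_weightE F U y : graph_weight F U y =
  \prod_(p : 'I_k * 'I_k | (p.1 < p.2)%N)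
    (if edge F p.1 p.2 then U (y p.1, y p.2) else 1 - U (y p.1, y p.2)).
Proof.
rewrite /graph_weight [RHS](bigID (fun p => edge F p.1 p.2)) /=.
congr (_ * _); apply: eq_bigr => p /andP[_]; first by move->.
by move/negbTE ->.
Qed.

Lemma graph_weight_measurable F U :
  measurable_fun setT U -> coord_measurable (graph_weight F U).
Proof.
move=> mU d' T h mh.
rewrite [X in measurable_fun _ X](_ : _ = fun t => \prod_(p : 'I_k * 'I_k)
  if (p.1 < p.2)%N then if edge F p.1 p.2 then U (h t p.1, h t p.2)
    else 1 - U (h t p.1, h t p.2) else 1); last first.
  by apply/funext => t; rewrite /comp graph_weightE big_mkcond.
apply: measurable_prod => p _.
have mp : measurable_fun setT (fun t => U (h t p.1, h t p.2)).
  by apply: measurableT_comp => //; apply: measurable_fun_pair.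
case: (_ < _)%N => //; case: (edge _ _ _) => //.
by apply: measurable_funB.
Qed.

(** For the upper bound, the factor of [ab] is kept and the product [q] of the others is bounded by
    [N] in absolute value; [2 * dl] pays for the possible negativity of either. *)
Lemma graph_weight_bounds F U y (dl : R) (a b : 'I_k) : a != b ->
  0 <= dl <= 1 ->
  (forall i j : 'I_k, (i < j)%N -> - dl <= U (y i, y j) <= 1 + dl) ->
  U (y b, y a) = U (y a, y b) ->
  - (dl * N) <= graph_weight F U y <=
    N * ((if edge F a b then U (y a, y b) else 1 - U (y a, y b)) + 2 * dl).
Proof.
move=> ab dl01 UB Usym; rewrite graph_weightE.
pose X (p : 'I_k * 'I_k) :=
  if edge F p.1 p.2 then U (y p.1, y p.2) else 1 - U (y p.1, y p.2).
rewrite (eq_bigr X) //.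
have XB (p : 'I_k * 'I_k) : (p.1 < p.2)%N -> - dl <= X p <= 1 + dl.
  by rewrite /X => /UB /andP[? ?]; case: ifP => _; apply/andP; split; lra.
apply/andP; split.
  by have [] := prod_almost_unit (index_enum _) dl01 XB.
(* The product only sees increasing pairs, so [ab] is oriented accordingly; symmetry of [U] makes
   this harmless. *)
pose p0 := if (a < b)%N then (a, b) else (b, a).
have p0P : (p0.1 < p0.2)%N.
  rewrite /p0; case: ifPn => //; rewrite -leqNgt leq_eqVlt => /orP[/eqP/val_inj ba|//].
  by rewrite ba eqxx in ab.
have -> : (if edge F a b then U (y a, y b) else 1 - U (y a, y b)) = X p0.
  by rewrite /X /p0; case: (a < b)%N => //=; rewrite edgeC Usym.
rewrite (bigD1 p0)//=.
have XB' (p : 'I_k * 'I_k) : (p.1 < p.2)%N && (p != p0) -> - dl <= X p <= 1 + dl.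
  by case/andP => /XB.
have [+ _] := prod_almost_unit (index_enum _) dl01 XB'.
rewrite -/N ler_norml; set q := \prod_(_ | _) _ => /andP[qN Nq].
have /andP[Xl _] := XB _ p0P.
have : 0 <= (X p0 + dl) * (N - q) by rewrite mulr_ge0//; lra.
have /andP[d0 _] := dl01.
have : 0 <= dl * (N + q) by rewrite mulr_ge0//; lra.
by lra.
Qed.

(** The factor of [ab] involves no integrated coordinate, so the pointwise bounds on the weight have
    constant ends and survive integration. *)
Lemma TF_bounds U (dl : R) : measurable_fun setT U -> 0 <= dl <= 1 ->
  {ae (pi \x pi)%E, forall z, U (z.1, z.2) = U (z.2, z.1)} ->
  {ae (pi \x pi)%E, forall z, - dl <= U z <= 1 + dl} ->
  {ae (pi \x pi)%E, forall z, forall F (a b : 'I_k), a != b ->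
    - (dl * N) <= TF pi F a b U z <=
    N * ((if edge F a b then U z else 1 - U z) + 2 * dl)}.
Proof.
move=> mU dl01 Usym UB.
pose P z := - dl <= U z <= 1 + dl.
have Pl := ae_section_l UB.
have Pr := ae_section_r UB.
(* Almost every [z] has both ends in [S], which is what [ae_coords_pairs] asks of the two
   coordinates fixed at the start. *)
pose S v := {ae pi, forall u, P (v, u)} /\ {ae pi, forall u, P (u, v)}.
have aeS : {ae pi, forall v, S v} by apply: filterS2 Pl Pr.
have aeS2 : {ae (pi \x pi)%E, forall z, S z.1 /\ S z.2}.
  by apply: filterS2 (ae_fst aeS) (ae_snd aeS).
have UB' := UB; apply: filterS3 Usym UB' aeS2.
move=> -[z1 z2] /= zsym zB [[Pl1 Pr1] [Pl2 Pr2]] F a b ab.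
have /andP[zl zu] := zB; have /andP[d0 _] := dl01.
have NB : - (dl * N) <=
    N * ((if edge F a b then U (z1, z2) else 1 - U (z1, z2)) + 2 * dl).
  rewrite -subr_ge0 opprK (mulrC dl) -mulrDr mulr_ge0//.
  by case: ifP => _; lra.
rewrite /TF; apply: integrate_coords_bounds => //.
  exact: graph_weight_measurable.
set s := [seq i <- _ | _].
have sE i : (i \notin s) = (i == a) || (i == b).
  by rewrite mem_filter mem_enum andbT negb_and !negbK.
have : ae_coords pi s
    (fun y => forall i j : 'I_k, (i < j)%N -> P (y i, y j))
    (fun i => if i == b then z2 else z1).
  apply: (ae_coords_pairs UB) => [j|i j].
    rewrite sE => /orP[] /eqP ->; last by rewrite eqxx.
    by rewrite (negbTE ab).
  rewrite !sE => /orP[] /eqP -> /orP[] /eqP ->;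
    rewrite ?eqxx ?ltnn ?(negbTE ab) //.
  by rewrite /P -zsym.
apply: ae_coordsS => y yE Py.
have ya : y a = z1 by rewrite yE ?sE ?eqxx// (negbTE ab).
have yb : y b = z2 by rewrite yE ?sE ?eqxx ?orbT.
by have := graph_weight_bounds F ab dl01 Py; rewrite ya yb; apply.
Qed.

(** Counts the graphs [F] and the vertices [a] and [b]; the sum over [H] costs nothing, since it is
    an average. *)
Definition velocity_rate : R :=
  #|{: sgraph k}|%:R * (#|'I_k|%:R * (#|'I_k|%:R * N)).

Lemma velocity_rate_ge0 : 0 <= velocity_rate.
Proof. by rewrite !mulr_ge0. Qed.

Lemma velocity_bounds (rule : sgraph k -> sgraph k -> R) U (dl : R) :
  is_rule rule -> measurable_fun setT U -> 0 <= dl <= 1 ->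
  {ae (pi \x pi)%E, forall z, U (z.1, z.2) = U (z.2, z.1)} ->
  {ae (pi \x pi)%E, forall z, - dl <= U z <= 1 + dl} ->
  {ae (pi \x pi)%E, forall z,
    - (velocity_rate * (U z + 2 * dl)) <= velocity pi rule U z <=
    velocity_rate * (1 - U z + 2 * dl)}.
Proof.
move=> [rule01 rule1] mU dl01 Usym UB.
apply: filterS2 UB (TF_bounds mU dl01 Usym UB) => z /andP[Ul Uu] TFB.
have /andP[d0 _] := dl01.
pose B1 := N * (U z + 2 * dl); pose B2 := N * (1 - U z + 2 * dl).
have B10 : 0 <= B1 by rewrite mulr_ge0//; lra.
have B20 : 0 <= B2 by rewrite mulr_ge0//; lra.
(* A term of the favourable sign can still err by [dl * N]; these two inequalities absorb that error
   into [B1] and [B2]. *)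
have NU1 : 0 <= N * (U z + dl) by rewrite mulr_ge0//; lra.
have NU2 : 0 <= N * (1 + dl - U z) by rewrite mulr_ge0//; lra.
rewrite /velocity_rate -!mulrA -/B1 -/B2.
have kB1 : 0 <= #|'I_k|%:R * (#|'I_k|%:R * B1) by rewrite mulr_ge0 // mulr_ge0.
have kB2 : 0 <= #|'I_k|%:R * (#|'I_k|%:R * B2) by rewrite mulr_ge0 // mulr_ge0.
apply: sum_bounds => // F _.
suff bnd H : - (#|'I_k|%:R * (#|'I_k|%:R * B1)) <=
    \sum_(a < k) \sum_(b < k | a != b) TF pi F a b U z *
      ((edge H a b && ~~ edge F a b)%:R - (edge F a b && ~~ edge H a b)%:R) <=
    #|'I_k|%:R * (#|'I_k|%:R * B2).
  have avg c : c = \sum_H rule F H * c by rewrite -mulr_suml rule1 mul1r.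
  rewrite [X in X <= _ <= _]avg [X in _ <= _ <= X]avg; apply/andP.
  split; apply: ler_sum => H _; have /andP[r0 _] := rule01 F H;
    have /andP[l u] := bnd H; exact: ler_wpM2l.
have k0 : 0 <= #|'I_k|%:R :> R by [].
apply: sum_bounds => [||a _]; [exact: mulr_ge0|exact: mulr_ge0|].
apply: sum_bounds => // b ab.
have /andP[] := TFB F a b ab; rewrite /B1 /B2 in B10 B20 *.
by case: (edge F a b); case: (edge H a b) => /= TFl TFu;
  rewrite ?subrr ?subr0 ?sub0r ?mulr0 ?mulrN ?mulr1; apply/andP; split; lra.
Qed.

End velocity_bounds.

(** * Real-variable tools: limits of inequalities, induction on time, one-step estimates *)

Lemma le_vanishing_error (R : realType) (a b M : R) :
  (forall n : nat, a <= b + M / n.+1%:R) -> a <= b.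
Proof.
move=> ab; apply/ler_addgt0Pr => e e0.
have [M0|M0] := leP M 0.
  by have := ab 0%N; rewrite divr1; lra.
pose n := Num.bound (M / e).
have nP : M / e < n%:R by apply: archi_boundP; rewrite divr_ge0// ltW.
apply: le_trans (ab n) _; rewrite lerD2l ler_pdivrMr// mulrC -ler_pdivrMr//.
by apply/ltW/(lt_trans nP); rewrite ltr_nat.
Qed.

(** If [Q] failed at [t], the times up to which [Q] holds would have a supremum; closure from the
    left gives [Q] there, and the step to the right goes past it. *)
Lemma real_induction (R : realType) (Q : R -> Prop) : Q 0 ->
  (forall s, 0 <= s -> Q s ->
    exists2 e, 0 < e & forall u, s < u < s + e -> Q u) ->
  (forall s, 0 < s -> (forall u, 0 <= u < s -> Q u) -> Q s) ->
  forall s, 0 <= s -> Q s.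
Proof.
move=> Q0 Qr Ql t t0; apply: contrapT => nQt.
pose A := [set s | 0 <= s /\ forall u, 0 <= u <= s -> Q u].
have A0 : A 0.
  by split=> // u /andP[u0 u1]; rewrite (_ : u = 0)//; apply/eqP; rewrite eq_le u0 u1.
have At : ubound A t.
  move=> s [s0 As]; rewrite leNgt; apply/negP => ts; apply: nQt; apply: As.
  by rewrite t0 ltW.
have supA : has_sup A by split; [exists 0|exists t].
set sg := sup A.
have sg0 : 0 <= sg by apply: sup_upper_bound.
have Qlt u : 0 <= u < sg -> Q u.
  move=> /andP[u0 us].
  have : 0 < sg - u by rewrite subr_gt0.
  move=> /sup_adherent/(_ supA)[s [_ As]]; rewrite subKr => us'.
  by apply: As; rewrite u0 ltW.
have Qsg : Q sg.
  by move: sg0; rewrite le_eqVlt => /predU1P[<-//|sg0]; exact: Ql.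
have [e e0 Qe] := Qr _ sg0 Qsg.
suff : A (sg + e / 2) by move/(sup_upper_bound supA); rewrite -/sg; lra.
split=> [|u /andP[u0 ue]]; first by lra.
have [us|us|->//] := ltgtP u sg; first by apply: Qlt; rewrite u0.
by apply: Qe; rewrite us /=; lra.
Qed.

(** The surplus 1 in the rate [C + 1] beats the second-order term: [(1 - C h)(1 + (C + 1) h) = 1 + h
    (1 - h C (C + 1)) >= 1]. *)
Lemma expR_decay_step (R : realType) (C s h : R) : 0 <= C -> 0 <= h ->
  h * (C * (C + 1)) <= 1 ->
  expR (- (C + 1) * (s + h)) <= (1 - C * h) * expR (- (C + 1) * s).
Proof.
move=> C0 h0 hC; rewrite mulrDr expRD mulrC ler_wpM2r ?expR_ge0//.
have x0 : 0 < 1 + (C + 1) * h.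
  by have : 0 <= (C + 1) * h; [rewrite mulr_ge0//|]; lra.
apply: (@le_trans _ _ (1 + (C + 1) * h)^-1).
  rewrite mulNr expRN lef_pV2 ?posrE ?expR_gt0//; exact: expR_ge1Dx.
rewrite -div1r ler_pdivrMr//.
have : 0 <= h * (1 - h * (C * (C + 1))) by rewrite mulr_ge0// subr_ge0.
by lra.
Qed.

(* One Euler step for the lower barrier [m * W - dl]; the upper barrier is the
   same statement for [1 - W] and [1 - U]. *)
Lemma barrier_step (R : realFieldType) (C h m m' w u u' v dl : R) :
  0 <= C -> 0 <= h -> C * h <= 1 -> m' <= (1 - C * h) * m -> 0 <= w -> 0 <= dl ->
  m * w - dl <= u -> - (C * (u + 2 * dl)) <= v -> u + h * v - dl * h <= u' ->
  m' * w - dl * (1 + (2 * C + 1) * h) <= u'.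
Proof.
move=> C0 h0 Ch mm' w0 d0 ul vl u'l.
have := ler_wpM2r w0 mm'.
have := ler_wpM2l h0 vl.
have : 0 <= (1 - C * h) * (u - (m * w - dl)) by rewrite mulr_ge0//; lra.
have : 0 <= C * h * dl by rewrite !mulr_ge0.
by lra.
Qed.

(** * Propagation of the barriers along the flow *)

Section trajectory.
Context (R : realType) (d : measure_display) (Omega : measurableType d)
  (pi : probability Omega R) (k : nat) (rule : sgraph k -> sgraph k -> R)
  (rule_ok : is_rule rule) (W : Omega * Omega -> R)
  (W_graphon : is_graphon pi W) (Phi : R -> Omega * Omega -> R)
  (Phi_flow : is_trajectory pi rule W Phi).

Lemma trajectory_increment (t eta : R) : 0 <= t -> 0 < eta ->
  exists2 e : R, 0 < e & forall s, 0 <= s -> s != t -> `|s - t| < e ->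
    {ae (pi \x pi)%E, forall z,
      `|Phi s z - Phi t z - (s - t) * velocity pi rule (Phi t) z|
        <= eta * `|s - t|}.
Proof.
move=> t0 eta0; have [_ _ /(_ t t0) Phi't] := Phi_flow.
have : nbhs (0%E : \bar R) [set y | (y < eta%:E)%E].
  by apply: open_ereal_lt'; rewrite lte_fin.
move=> /Phi't; rewrite /= /nbhs /= /within /= => /nbhs_ballP[e /= e0 He].
exists e => // s s0 st ste.
have := He s; rewrite /ball /= distrC => /(_ ste st s0).
(* The L^oo norm is an essential supremum only when the space has positive measure. *)
rewrite unlock ifT; last first.
  by rewrite [X in (0 < X)%E]probability_setT lte01.
move=> /ltW/ess_supP; apply: filterS => z /=.
rewrite lee_fin => H.
have st0 : s - t != 0 by rewrite subr_eq0.
have -> : Phi s z - Phi t z - (s - t) * velocity pi rule (Phi t) z =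
  ((s - t)^-1 * (Phi s z - Phi t z) - velocity pi rule (Phi t) z) * (s - t).
  by field.
by rewrite normrM ler_wpM2r.
Qed.

Let C : R := velocity_rate R k.
Let K : R := 2 * C + 1.
Let m (s : R) : R := expR (- (C + 1) * s).

Let C_ge0 : 0 <= C. Proof. exact: velocity_rate_ge0. Qed.

(** The exceptional null set may depend on [s]; the induction on time therefore handles this whole
    statement, not individual points [z]. *)
Definition within_barriers (s dl : R) : Prop :=
  {ae (pi \x pi)%E, forall z,
    m s * W z - dl <= Phi s z <= 1 - m s * (1 - W z) + dl}.

Lemma barriers_step (s dl : R) : 0 <= s -> 0 < dl <= 1 -> within_barriers s dl ->
  exists2 e : R, 0 < e & forall h, 0 < h < e ->
    within_barriers (s + h) (dl * (1 + K * h)).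
Proof.
move=> s0 /andP[d0 d1] Bs.
have [_ W01] := W_graphon; have [Ker _ _] := Phi_flow.
have [mPhi _ Phisym] := Ker s s0.
have dl01 : 0 <= dl <= 1 by rewrite ltW.
have UB : {ae (pi \x pi)%E, forall z, - dl <= Phi s z <= 1 + dl}.
  apply: filterS2 W01 Bs => z /andP[w0 w1] /andP[l u].
  have : 0 <= m s * W z by rewrite mulr_ge0// expR_ge0.
  have : 0 <= m s * (1 - W z) by rewrite mulr_ge0 ?expR_ge0// subr_ge0.
  by move=> ? ?; apply/andP; split; lra.
have VB := velocity_bounds rule_ok mPhi dl01 Phisym UB.
(* The Euler error is taken as [dl] itself, so that it contributes [dl * h], the summand 1 of
   [K]. *)
have [e e0 He] := trajectory_increment s0 d0.
have D0 : 0 < 1 + C * (C + 1).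
  by have : 0 <= C * (C + 1); [rewrite mulr_ge0// addr_ge0|lra].
have D1 : 0 < 1 + C by have := C_ge0; lra.
(* The last two terms ensure [C h <= 1] and [h C (C + 1) <= 1]; the added 1 keeps the denominators
   positive if [C = 0]. *)
exists (Num.min e (Num.min (1 + C)^-1 (1 + C * (C + 1))^-1)).
  by rewrite !lt_min e0 !invr_gt0 D0 D1.
move=> h /andP[h0]; rewrite !lt_min => /and3P[he].
rewrite -div1r ltr_pdivlMr// -div1r ltr_pdivlMr// => hC1 hC2.
have hC : h * (C * (C + 1)) <= 1 by lra.
have Ch : C * h <= 1 by lra.
have := He (s + h) (addr_ge0 s0 (ltW h0)).
rewrite [s + h - s]addrAC subrr add0r (gtr0_norm h0) => /(_ _ he) inc.
rewrite -subr_eq0 addrAC subrr add0r in inc; have {}inc := inc (lt0r_neq0 h0).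
have mh := expR_decay_step s C_ge0 (ltW h0) hC.
apply: filterS2 (filterI W01 Bs) (filterI VB inc) => z.
move=> [/andP[w0 w1] /andP[l u]] [/andP[vl vu]]; rewrite ler_norml => /andP[il iu].
have w10 : 0 <= 1 - W z by rewrite subr_ge0.
apply/andP; split.
  by apply: (barrier_step C_ge0 (ltW h0) Ch mh w0 (ltW d0) l vl); lra.
have u' : m s * (1 - W z) - dl <= 1 - Phi s z by lra.
have v' : - (C * (1 - Phi s z + 2 * dl)) <= - velocity pi rule (Phi s) z.
  by rewrite lerN2.
suff : m (s + h) * (1 - W z) - dl * (1 + K * h) <= 1 - Phi (s + h) z by lra.
by apply: (barrier_step C_ge0 (ltW h0) Ch mh w10 (ltW d0) u' v'); lra.
Qed.

(** A sequence of earlier times suffices, so one null set serves for all of them. As [m] decreases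
    and [dl] does not, passing from an earlier time to [s] only weakens the barriers. *)
Lemma barriers_limit (s : R) (dl : R -> R) : 0 < s ->
  {homo dl : u v / u <= v} ->
  (forall u, 0 <= u < s -> within_barriers u (dl u)) -> within_barriers s (dl s).
Proof.
move=> s0 dl_nd Bu.
have [_ W01] := W_graphon.
have [e e0 He] := trajectory_increment (ltW s0) ltr01.
pose c := Num.min s e.
have c0 : 0 < c by rewrite lt_min s0.
have cs : c <= s by rewrite ge_min lexx.
have ce : c <= e by rewrite ge_min lexx orbT.
(* With [n.+2], already [a 0 < c], so [s - a n] is positive and within [e] of [s]. *)
pose a (n : nat) := c / n.+2%:R.
have a0 n : 0 < a n by rewrite divr_gt0.
have ac n : a n < c by rewrite ltr_pdivrMr// ltr_pMr// ltr1n.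
have Bn : {ae (pi \x pi)%E, forall z, forall n,
    m (s - a n) * W z - dl (s - a n) <= Phi (s - a n) z
    <= 1 - m (s - a n) * (1 - W z) + dl (s - a n)}.
  apply: ae_foralln => n; apply: Bu; have := a0 n; have := ac n.
  by move=> ? ?; apply/andP; split; lra.
have In : {ae (pi \x pi)%E, forall z, forall n,
    `|Phi (s - a n) z - Phi s z - - a n * velocity pi rule (Phi s) z| <= a n}.
  apply: ae_foralln => n; have := He (s - a n).
  rewrite [s - a n - s]addrAC subrr add0r normrN (gtr0_norm (a0 n)) mul1r; apply.
  - by have := ac n; lra.
  - by have := a0 n; rewrite lt_neqAle => /andP[a_neq0 _]; apply/eqP; lra.
  - exact: lt_le_trans (ac n) ce.
apply: filterS3 W01 Bn In => z /andP[w0 w1] Bz Iz.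
set V := velocity pi rule (Phi s) z in Iz.
(* At fixed [z] the increment over [a n] is at most this quantity, which tends to 0. *)
have err n : a n * (`|V| + 1) <= c * (`|V| + 1) / n.+1%:R.
  rewrite /a [c / _ * _]mulrAC ler_wpM2l//.
    by rewrite mulr_ge0 ?addr_ge0// ltW.
  by rewrite lef_pV2 ?posrE// ler_nat.
have aV n : `|a n * V| <= a n * `|V| by rewrite normrM (gtr0_norm (a0 n)).
have mdec n : m s <= m (s - a n).
  rewrite ler_expR; have : 0 <= (C + 1) * a n; last by lra.
  by rewrite mulr_ge0 ?addr_ge0// ltW.
have w1' : 0 <= 1 - W z by rewrite subr_ge0.
have dle n : dl (s - a n) <= dl s by apply: dl_nd; have := a0 n; lra.
clearbody a V.
apply/andP; split; apply: (@le_vanishing_error _ _ _ (c * (`|V| + 1))) => n.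
  have e1 := ler_wpM2r w0 (mdec n); have /andP[e2 _] := Bz n.
  have := aV n; have := Iz n; rewrite !ler_norml => /andP[i1 i2] /andP[j1 j2].
  have e3 := dle n; have e4 := err n.
  have inc : Phi (s - a n) z <= Phi s z + a n * (`|V| + 1) by lra.
  exact: le_trans (lerB e1 e3) (le_trans e2 (le_trans inc (lerD (lexx _) e4))).
have e1 := ler_wpM2r w1' (mdec n); have /andP[_ e2] := Bz n.
have := aV n; have := Iz n; rewrite !ler_norml => /andP[i1 i2] /andP[j1 j2].
have e3 := dle n; have e4 := err n.
have inc : Phi s z <= Phi (s - a n) z + a n * (`|V| + 1) by lra.
apply: le_trans inc (lerD _ e4); apply: le_trans e2 (lerD _ e3).
by rewrite lerB.
Qed.

(** Real induction up to [t], vacuous afterwards; the smallness of [eps] keeps the error at most 1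
    throughout, and [1 + K h <= exp (K h)] turns the step factor into exponential growth. *)
Lemma barriers_growth (eps t : R) : 0 < eps -> eps * expR (K * t) <= 1 -> 0 <= t ->
  within_barriers t (eps * expR (K * t)).
Proof.
move=> eps0 epst t0.
have K0 : 0 <= K by rewrite /K; have := C_ge0; lra.
suff Q s : 0 <= s -> s <= t -> within_barriers s (eps * expR (K * s)) by exact: Q.
have nd : {homo (fun u => eps * expR (K * u)) : u v / u <= v}.
  by move=> u v uv /=; rewrite ler_wpM2l ?(ltW eps0)// ler_expR ler_wpM2l.
move: s; apply: real_induction => [_|s s0 Qs|s s0 Qs st].
- have [_ Phi0 _] := Phi_flow; have [_ W01] := W_graphon.
  apply: filterS2 Phi0 W01 => z -> /andP[w0 w1].
  by rewrite /m !mulr0 expR0; apply/andP; split; lra.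
- have [st|ts] := ltP s t; last first.
    by exists 1 => // u /andP[su _] ut; have := lt_le_trans su ut; rewrite ltNge ts.
  have dl0 : 0 < eps * expR (K * s) by rewrite mulr_gt0// expR_gt0.
  have [|e e0 He] := barriers_step s0 _ (Qs (ltW st)).
    by rewrite dl0 /= (le_trans _ epst)// nd// ltW.
  exists e => // u /andP[su ue] _.
  have /He : 0 < u - s < e by apply/andP; split; lra.
  rewrite addrC subrK.
  have : eps * expR (K * s) * (1 + K * (u - s)) <= eps * expR (K * u).
    rewrite -mulrA ler_wpM2l ?(ltW eps0)//.
    rewrite (_ : K * u = K * s + K * (u - s)); last by ring.
    by rewrite expRD ler_wpM2l ?expR_ge0// expR_ge1Dx.
  by move=> le; apply: filterS => z /andP[l r]; apply/andP; split; lra.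
- by apply: (barriers_limit s0 nd) => u /andP[u0 us]; apply: Qs;
    rewrite ?u0 ?us//; exact: le_trans (ltW us) st.
Qed.

Lemma trajectory_barriers (t : R) : 0 <= t ->
  exists2 c : R, 0 < c &
    {ae (pi \x pi)%E, forall z, c * W z <= Phi t z <= 1 - c * (1 - W z)}.
Proof.
move=> t0; exists (m t); first exact: expR_gt0.
have : {ae (pi \x pi)%E, forall z, forall n : nat,
    m t * W z - n.+1%:R^-1 <= Phi t z <= 1 - m t * (1 - W z) + n.+1%:R^-1}.
  apply: ae_foralln => n.
  (* The initial error is chosen so that it has grown to exactly [1 / (n + 1)] at time [t]. *)
  have E : n.+1%:R^-1 = n.+1%:R^-1 * expR (- (K * t)) * expR (K * t).
    by rewrite -mulrA -expRD addNr expR0 mulr1.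
  rewrite E; apply: barriers_growth => //.
    by rewrite mulr_gt0 ?invr_gt0// expR_gt0.
  by rewrite -E invf_le1// ler1n.
apply: filterS => z Bz; apply/andP; split;
  apply: (@le_vanishing_error _ _ _ 1) => n; have /andP[l u] := Bz n;
  by rewrite div1r // -lerBlDr.
Qed.

End trajectory.

(** * From the barriers to the two null sets *)

Theorem proposition6p7 (R : realType) (d : measure_display)
    (Omega : measurableType d) (pi : probability Omega R)
    (pi_atomless : atomless pi) (pi_separable : separable pi)
    (k : nat) (rule : sgraph k -> sgraph k -> R) (rule_ok : is_rule rule)
    (W : Omega * Omega -> R) (W_graphon : is_graphon pi W)
    (Phi : R -> Omega * Omega -> R) (Phi_flow : is_trajectory pi rule W Phi)
    (t : R) (t_gt0 : 0 < t) :
  (pi \x pi)%E [set z | 0 < W z /\ Phi t z = 0] = 0%E /\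
  (pi \x pi)%E [set z | W z < 1 /\ Phi t z = 1] = 0%E.
Proof.
have [[mW _ _] _] := W_graphon.
have [/(_ t (ltW t_gt0))[mPhi _ _] _ _] := Phi_flow.
have [c c0 B] := trajectory_barriers rule_ok W_graphon Phi_flow (ltW t_gt0).
have mPhi_eq r : measurable [set z | Phi t z = r].
  by rewrite -[X in measurable X]setTI; exact: (mPhi measurableT [set r]).
split.
  apply: measure_negligible.
    apply: measurableI (mPhi_eq 0).
    rewrite -[X in measurable X]setTI; have := mW measurableT `]0, +oo[%classic.
    by rewrite /preimage /= => /(_ (measurable_itv _)); congr measurable;
      apply/seteqP; split=> z /=; rewrite in_itv/= andbT.
  (* Where [W z > 0], the lower barrier [c * W z] excludes the value 0, so the set lies in the
     exceptional null set. *)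
  apply: negligibleS B => z /= [w0 Phi0]; rewrite Phi0 => /andP[+ _].
  by apply/negP; rewrite -ltNge mulr_gt0.
apply: measure_negligible.
  apply: measurableI (mPhi_eq 1).
  rewrite -[X in measurable X]setTI; have := mW measurableT `]-oo, 1[%classic.
  by rewrite /preimage /= => /(_ (measurable_itv _)); congr measurable;
    apply/seteqP; split=> z /=; rewrite in_itv.
apply: negligibleS B => z /= [w1 Phi1]; rewrite Phi1 => /andP[_].
have : 0 < c * (1 - W z) by rewrite mulr_gt0// subr_gt0.
by lra.
Qed.
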